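(* Let $n,s,s'\in\mathbb{N}$ with $n\ge 2$ and $1\le 2s-1<2s'-1\le\lfloor n/2\rfloor$, and let $R=\{2,\,2s-1,\,2s'-1\}$. If for some $t$ with $0\le t\le\lfloor n/2\rfloor$ the graphs $\theta_{n,2,t}(C_n(R))$ and $C_n(R)$ are isomorphic circulant graphs of Type-2 with respect to $m=2$, then $n\equiv 0\pmod 8$, $(2s-1)+(2s'-1)=\frac n2$, $2s-1\neq\frac n8$, $t=\frac n8$ or $t=\frac{3n}8$, $1\le 2s-1\le\frac n4$, and $n\ge 16$. In particular, for $n,s\in\mathbb{N}$ with $n\ge 2$, $1\le 2s-1\le 2n-1$, $n\ne 2s-1$, and $R=\{2,\,2s-1,\,4n-(2s-1)\}$, $S=\{2,\,2n-(2s-1),\,2n+2s-1\}$, one has $\theta_{8n,2,n}(C_{8n}(R))=C_{8n}(S)=\theta_{8n,2,3n}(C_{8n}(R))$, $\theta_{8n,2,n}(C_{8n}(S))=C_{8n}(R)=\theta_{8n,2,3n}(C_{8n}(S))$, $\theta_{8n,2,2n}(C_{8n}(R))=C_{8n}(R)$, $\theta_{8n,2,2n}(C_{8n}(S))=C_{8n}(S)$, and $C_{8n}(R)$ and $C_{8n}(S)$ are Type-2 isomorphic with respect to $m=2$.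
   Context: Circulant graph: for $n\in\mathbb{N}$ and a set $R\subseteq\{1,\dots,\lfloor n/2\rfloor\}$ of jump sizes, $C_n(R)$ is the graph with vertex set $\mathbb{Z}_n$ (vertex $i$ also written $v_i$) in which $i$ is adjacent to $i\pm r$ (mod $n$) for each $r\in R$. Reflexive modulo $n$: for $y\in\mathbb{Z}$, $yR$ computed under reflexive modulo $n$ is the set obtained by reducing each $yr$ ($r\in R$) modulo $n$ and replacing any residue $r'>n/2$ by $n-r'$. Let $\varphi_n=\{y\in\mathbb{Z}_n:\gcd(n,y)=1\}$. The map $\theta_{n,m,t}$: for a divisor $m>1$ of $n$ and an integer $t\ge 0$ (only $t$ modulo $\frac nm$ matters), $\theta_{n,m,t}:\mathbb{Z}_n\to\mathbb{Z}_n$ is $\theta_{n,m,t}(x)=x+jtm \pmod n$, where $x=qm+j$, $0\le j\le m-1$, $0\le q\le \frac nm-1$. The graph $\theta_{n,m,t}(C_n(R))$ has vertex set $\mathbb{Z}_n$ and edges $\{\theta_{n,m,t}(x),\theta_{n,m,t}(x+s)\}$ for $x\in\mathbb{Z}_n$, $s\in R$. Equality of graphs means equality as labelled graphs on $\mathbb{Z}_n$. Type-2 isomorphism with respect to $m$: let $|R|\ge 3$, $r\in R$, $m>1$, $m\mid\gcd(n,r)$ and $m^3\mid n$ (these conditions are part of the definition). If for a particular $t$ one has $\theta_{n,m,t}(C_n(R))=C_n(S)$ for some $S\subseteq\{1,\dots,\lfloor n/2\rfloor\}$, and $S\ne yR$ (under reflexive modulo $n$) for all $y\in\varphi_n$,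 then $C_n(R)$ and $C_n(S)=\theta_{n,m,t}(C_n(R))$ are called isomorphic circulant graphs of Type-2 with respect to $m$ (Type-2 isomorphic with respect to $m$). *)

(* Defs.v *)
From HB Require Import structures.
From mathcomp Require Import all_boot all_order all_algebra finmap.

Set Implicit Arguments.
Unset Strict Implicit.
Unset Printing Implicit Defensive.

Import GRing.Theory.

(* The vertex set Z_n is 'Z_n, which is the ring Z/nZ only when 1 < n; for
   smaller n it is Z/2Z. Graphs on Z_n are given by their sets of edges, so
   Leibniz equality is equality of labelled graphs. *)

Definition jump_set (n : nat) (R : {fset nat}) : Prop :=
  forall r : nat, r \in R -> 1 <= r <= n %/ 2.

Definition circ_adj (n : nat) (R : {fset nat}) : rel 'Z_n :=
  fun x y => [exists r : R, (y == (x + (val r)%:R)%R) || (y == (x - (val r)%:R)%R)].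

Definition circulant (n : nat) (R : {fset nat}) : {set {set 'Z_n}} :=
  [set e : {set 'Z_n} | [exists x, exists y, circ_adj R x y && (e == [set x; y])]].

Definition theta (n m t : nat) (x : 'Z_n) : 'Z_n :=
  (x + ((x %% m) * t * m)%N%:R)%R.

Definition theta_circulant (n m t : nat) (R : {fset nat}) : {set {set 'Z_n}} :=
  [set [set theta m t x; theta m t (x + (val s)%:R)%R] | x : 'Z_n, s : R].

Definition reflexive_mod (n a : nat) : nat :=
  if n < 2 * (a %% n) then n - a %% n else a %% n.

(* Multipliers are only ever taken in {y in Z_n | gcd(n, y) = 1}, represented
   below by the naturals y < n coprime to n. *)
Definition reflexive_mul (n y : nat) (R : {fset nat}) : {fset nat} :=
  [fset reflexive_mod n (y * r) | r in R]%fset.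

(* C_n(R) and C_n(S) = theta_{n,m,t}(C_n(R)) are Type-2 isomorphic with respect
   to m, for this particular t. *)
Definition type2_via (n m t : nat) (R S : {fset nat}) : Prop :=
  [/\ jump_set n R /\ jump_set n S,
      [/\ 3 <= #|` R|, 1 < m, (exists2 r, r \in R & m %| gcdn n r) & m ^ 3 %| n],
      theta_circulant n m t R = circulant n S
    & forall y : nat, y < n -> coprime n y -> S <> reflexive_mul n y R].

Definition type2 (n m : nat) (R S : {fset nat}) : Prop :=
  exists t : nat, type2_via n m t R S.

(* Main.v *)
(* The map theta_{n,2,t} fixes even vertices and shifts odd ones by c = 2t, so
   the image of C_n({2,a,b}), with a and b odd, has the same edges between
   vertices of equal parity, while an even x is joined to x + d + c for d in
   A = {a,-a,b,-b}. The image is a circulant graph iff A + c is symmetric, and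
   then A + 4t = A. As 2a is neither 0 nor 4t nor -4t, this leaves 4t = 0 or
   (8t = 0 and b = a + 4t or -a - 4t). If 4t = 0, the image is C_n(yR) with
   y = 1 or y = 1 + n/2, which is not of Type-2. Otherwise 4t = n/2 and
   a + b = n/2; moreover a = n/8 would give A + c = A. For the family,
   A shifted by a quarter of the order is the set of odd jumps of S, up to sign. *)
Require Import Defs.
From HB Require Import structures.
From mathcomp Require Import all_boot all_order all_algebra finmap.
From mathcomp Require Import zify ring.

Set Implicit Arguments.
Unset Strict Implicit.
Unset Printing Implicit Defensive.

Import GRing.Theory.

Section TypeTwo.
Local Open Scope ring_scope.

(** * Residues of naturals and unordered pairs *)

Lemma natZp_eq (N : nat) (a b : nat) : (1 < N)%N ->
  (a%:R == b%:R :> 'Z_N) = (a == b %[mod N]).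
Proof. by move=> N1; rewrite -val_eqE /= !val_Zp_nat. Qed.

Lemma natZp_eq0 (N : nat) (a : nat) : (1 < N)%N ->
  (a%:R == 0 :> 'Z_N) = (N %| a)%N.
Proof. by move=> N1; rewrite -[0]/(0%:R) natZp_eq // mod0n. Qed.

Lemma set2_eqP (T : finType) (x y u v : T) :
  [set x; y] = [set u; v] -> (x = u /\ y = v) \/ (x = v /\ y = u).
Proof.
move=> e.
have /set2P xuv : x \in [set u; v] by rewrite -e set21.
have /set2P yuv : y \in [set u; v] by rewrite -e set22.
have /set2P uxy : u \in [set x; y] by rewrite e set21.
have /set2P vxy : v \in [set x; y] by rewrite e set22.
by case: xuv yuv uxy vxy => ? [] ? [] ? [] ?; subst; auto.
Qed.

(** * Circulant graphs and their connection sets *)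

(** This is the symmetric connection set, the union of [R] and [-R]. Adjacency depends only on
    whether [y - x] lies in it, so equality of graphs becomes equality of these predicates. *)
Definition is_jump (N : nat) (R : {fset nat}) (z : 'Z_N) : bool :=
  [exists r : R, (z == (val r)%:R) || (z == - (val r)%:R)].

Lemma is_jumpP (N : nat) (R : {fset nat}) (z : 'Z_N) :
  reflect (exists2 r : nat, r \in R & z = r%:R \/ z = - r%:R) (is_jump R z).
Proof.
apply: (iffP existsP) => [[r /orP rz]|[r rR rz]].
  by exists (val r); [exact: valP | case: rz => /eqP; auto].
by exists [` rR]%fset; case: rz => -> /=; rewrite eqxx ?orbT.
Qed.

Lemma is_jumpN (N : nat) (R : {fset nat}) (z : 'Z_N) :
  is_jump R (- z) = is_jump R z.
Proof.
apply: eq_existsb => r.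
by rewrite orbC eqr_opp eqr_oppLR.
Qed.

Lemma is_jump3 (N a b c : nat) (z : 'Z_N) :
  is_jump [fset a; b; c]%fset z =
  [|| (z == a%:R) || (z == - a%:R), (z == b%:R) || (z == - b%:R)
    | (z == c%:R) || (z == - c%:R)].
Proof.
apply/is_jumpP/idP => [[r]|].
  by rewrite !inE -orbA => /or3P[] /eqP-> [] ->; rewrite eqxx ?orbT.
by case/or3P=> /orP[] /eqP->; [exists a | exists a | exists b | exists b
  | exists c | exists c]; rewrite ?inE ?eqxx ?orbT; auto.
Qed.

Lemma circ_adjE (N : nat) (R : {fset nat}) (x y : 'Z_N) :
  circ_adj R x y = is_jump R (y - x).
Proof. by apply: eq_existsb => r; rewrite !subr_eq ![_ + x]addrC. Qed.

Lemma mem_circulant (N : nat) (R : {fset nat}) (x y : 'Z_N) :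
  ([set x; y] \in circulant N R) = is_jump R (y - x).
Proof.
rewrite inE; apply/existsP/idP => [[u /existsP[v]]|xy].
  rewrite circ_adjE => /andP[uv /eqP/set2_eqP[][-> ->]] //.
  by rewrite -is_jumpN opprB.
by exists x; apply/existsP; exists y; rewrite circ_adjE xy eqxx.
Qed.

Lemma jump_set_is_jump (N : nat) (R : {fset nat}) (r : nat) :
  (1 < N)%N -> jump_set N R -> (1 <= r <= N %/ 2)%N ->
  is_jump R (r%:R : 'Z_N) = (r \in R).
Proof.
move=> N1 jR rN; apply/is_jumpP/idP => [[q qR]|rR]; last by exists r; auto.
have qN := jR q qR.
case=> [/eqP|/eqP].
  rewrite natZp_eq // !modn_small; [by move/eqP-> | lia | lia].
rewrite -addr_eq0 -natrD natZp_eq0 // => /dvdnP[k rq].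
(* Both summands are positive and at most N/2, so [r + q] can only be N, with r = q = N/2. *)
suff -> : r = q by [].
have : (0 < k < 2)%N by nia.
by case: k rq => [|[|k]] //; lia.
Qed.

Lemma is_jump_inj (N : nat) (R S : {fset nat}) :
  (1 < N)%N -> jump_set N R -> jump_set N S ->
  (forall z : 'Z_N, is_jump R z = is_jump S z) -> R = S.
Proof.
move=> N1 jR jS e; apply/fsetP => r.
case rN: (1 <= r <= N %/ 2)%N.
  by rewrite -(jump_set_is_jump N1 jR rN) e jump_set_is_jump.
by apply/idP/idP => [/jR|/jS]; rewrite rN.
Qed.

(** The edges at vertex 0 recover the connection set, and each class up to sign has only one
    representative between 1 and N/2. *)
Lemma circulant_inj (N : nat) (R S : {fset nat}) :
  (1 < N)%N -> jump_set N R -> jump_set N S ->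
  circulant N R = circulant N S -> R = S.
Proof.
move=> N1 jR jS e; apply: (is_jump_inj N1) => // z.
by rewrite -(subr0 z) -!mem_circulant e.
Qed.

(** * Multiples under reflexive reduction *)

Lemma reflexive_modE (N a : nat) : (1 < N)%N ->
  ((reflexive_mod N a)%:R = a%:R :> 'Z_N) \/
  ((reflexive_mod N a)%:R = - a%:R :> 'Z_N).
Proof.
move=> N1.
have modE : (a %% N)%:R = a%:R :> 'Z_N.
  by apply/eqP; rewrite natZp_eq // modn_mod.
rewrite /reflexive_mod; case: ifP => _; [right | by left].
rewrite natrB; last by rewrite ltnW // ltn_mod; lia.
by rewrite modE pchar_Zp // sub0r.
Qed.

(** Reflexive reduction changes a residue at most by its sign, which a connection set does not
    see. *)
Lemma is_jump_reflexive_mul (N y : nat) (R : {fset nat}) (z : 'Z_N) :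
  (1 < N)%N ->
  reflect (exists2 r : nat, r \in R & z = (y * r)%:R \/ z = - (y * r)%:R)
    (is_jump (reflexive_mul N y R) z).
Proof.
move=> N1; apply: (iffP (is_jumpP _ _)) => [[q /imfsetP[/= r rR ->] zq]|[r rR zr]].
  exists r => //.
  by case: (reflexive_modE (y * r) N1) zq => -> [] ->; rewrite ?opprK; auto.
exists (reflexive_mod N (y * r)); first by apply/imfsetP; exists r.
by case: (reflexive_modE (y * r) N1) zr => -> [] ->; rewrite ?opprK; auto.
Qed.

Lemma jump_set_reflexive_mul (N y : nat) (R : {fset nat}) :
  (1 < N)%N -> coprime N y -> jump_set N R -> jump_set N (reflexive_mul N y R).
Proof.
move=> N1 cNy jR _ /imfsetP[/= r rR ->].
have rN := jR r rR.
have ltN : (y * r %% N < N)%N by rewrite ltn_mod; lia.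
have gt0 : (0 < y * r %% N)%N.
  rewrite lt0n -/(N %| y * r)%N Gauss_dvdr //.
  by apply/negP => /dvdn_leq; lia.
by rewrite /reflexive_mod; case: ifP; lia.
Qed.

(** * Parity in Z_N for even N, and the twist with m = 2 *)

Section Even.
Variables (N : nat).
Hypotheses (N1 : (1 < N)%N) (Neven : ~~ odd N).

Lemma odd_ZpD (x y : 'Z_N) : odd (x + y)%R = odd x (+) odd y.
Proof.
rewrite -{1}(natr_Zp x) -{1}(natr_Zp y) -natrD val_Zp_nat //.
by rewrite odd_mod ?oddD //; apply: negbTE.
Qed.

Lemma odd_ZpN (x : 'Z_N) : odd (- x)%R = odd x.
Proof.
have := odd_ZpD x (- x); rewrite subrr /=.
by case: (odd x); case: (odd _).
Qed.

Lemma odd_Zp_nat (a : nat) : odd (a%:R : 'Z_N) = odd a.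
Proof. by rewrite val_Zp_nat // odd_mod //; apply: negbTE. Qed.

(** The inverse of [theta 2 t]: the shift 2t is even, so both maps preserve parity. *)
Definition untwist (t : nat) (x : 'Z_N) : 'Z_N :=
  if odd x then x - (2 * t)%:R else x.

Lemma theta2E (t : nat) (x : 'Z_N) :
  theta 2 t x = if odd x then x + (2 * t)%:R else x.
Proof.
rewrite /theta modn2; case: (odd x); last by rewrite !mul0n addr0.
by rewrite mul1n mulnC.
Qed.

Lemma untwistK (t : nat) : cancel (untwist t) (theta 2 t).
Proof.
move=> x; rewrite theta2E /untwist; case xodd: (odd x); last by rewrite xodd.
by rewrite odd_ZpD odd_ZpN odd_Zp_nat xodd oddM /= subrK.
Qed.

Lemma thetaK (t : nat) : cancel (theta 2 t) (untwist t).
Proof.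
move=> x; rewrite theta2E /untwist; case xodd: (odd x); last by rewrite xodd.
by rewrite odd_ZpD odd_Zp_nat xodd oddM /= addrK.
Qed.

Lemma mem_theta_circulant (t : nat) (R : {fset nat}) (x y : 'Z_N) :
  ([set x; y] \in theta_circulant N 2 t R) =
  is_jump R (untwist t y - untwist t x).
Proof.
apply/imset2P/is_jumpP => [[u s _ _ /set2_eqP[][-> ->]]|[r rR e]].
- by rewrite !thetaK; exists (val s); [exact: valP | left; ring].
- by rewrite !thetaK; exists (val s); [exact: valP | right; ring].
case: e => /eqP; rewrite subr_eq => /eqP e.
  exists (untwist t x) [` rR]%fset => //=.
  by rewrite addrC -e !untwistK.
exists (untwist t y) [` rR]%fset => //=.
rewrite setUC; congr [set _; _]; rewrite ?untwistK //.
by rewrite e addrAC addNr add0r untwistK.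
Qed.

(** Edges at the even vertex 0 suffice: for two odd ends the shifts cancel, and for ends of
    different parity the even one may be taken first. *)
Lemma theta_circulantP (t : nat) (R S : {fset nat}) :
  theta_circulant N 2 t R = circulant N S <->
  forall z : 'Z_N, is_jump S z = is_jump R (untwist t z).
Proof.
split=> [e z|e].
  rewrite -[in LHS](subr0 z) -mem_circulant -e mem_theta_circulant.
  by rewrite [untwist t 0]/untwist /= subr0.
have pairE x y : ([set x; y] \in theta_circulant N 2 t R) =
                 ([set x; y] \in circulant N S).
  rewrite mem_theta_circulant mem_circulant.
  (* Connection sets are symmetric, so exchanging the ends removes the case of odd [x] and even
     [y]. *)
  wlog xy : x y / odd x ==> odd y => [wl|].
    case: (boolP (odd x ==> odd y)) => [|xy]; first exact: wl.
    rewrite -is_jumpN -[in RHS]is_jumpN !opprB; apply: wl.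
    by move: xy; case: (odd x); case: (odd y).
  rewrite e /untwist odd_ZpD odd_ZpN; move: xy.
  case: (odd x); case: (odd y) => //= _; congr is_jump; ring.
apply/setP => E; apply/idP/idP => EE.
  have /imset2P[x s _ _ Exs] := EE; move: EE.
  by rewrite Exs pairE.
have := EE; rewrite inE => /existsP[x /existsP[y /andP[_ /eqP Exy]]]; move: EE.
by rewrite Exy pairE.
Qed.

(** * Jump sets with one even and two odd elements *)

Lemma is_jump_parity (e a b : nat) (z : 'Z_N) :
  ~~ odd e -> odd a -> odd b ->
  is_jump [fset e; a; b]%fset z =
  if odd z then [|| z == a%:R, z == - a%:R, z == b%:R | z == - b%:R]
  else (z == e%:R) || (z == - e%:R).
Proof.
move=> oe oa ob; rewrite is_jump3.
have neq (r : nat) : odd r != odd z -> (z == r%:R) || (z == - r%:R) = false.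
  by apply: contraNF => /orP[] /eqP->; rewrite ?odd_ZpN odd_Zp_nat.
case: ifP => oz; first by rewrite (neq e) -?orbA // (negbTE oe) oz.
by rewrite (neq a) ?(neq b) ?orbF // ?oa ?ob oz.
Qed.

Lemma is_jump_untwist (t e a b : nat) (z : 'Z_N) :
  ~~ odd e -> odd a -> odd b ->
  is_jump [fset e; a; b]%fset (untwist t z) =
  if odd z then
    let c := (2 * t)%:R in
    [|| z == a%:R + c, z == - a%:R + c, z == b%:R + c | z == - b%:R + c]
  else (z == e%:R) || (z == - e%:R).
Proof.
move=> oe oa ob; rewrite is_jump_parity // /untwist.
case oz: (odd z); last by rewrite oz.
by rewrite odd_ZpD odd_ZpN odd_Zp_nat oddM oz /= !subr_eq.
Qed.

(** Even jumps stay and odd ones move by 2t. The even jumps are compared only in Z_N, so that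
    unreduced multiples such as [y * 2] are allowed. *)
Lemma theta_circulant3 (t e a b e' a' b' : nat) :
  ~~ odd e -> odd a -> odd b -> ~~ odd e' -> odd a' -> odd b' ->
  e'%:R = e%:R :> 'Z_N ->
  let c := (2 * t)%:R : 'Z_N in
  [:: a'%:R; - a'%:R; b'%:R; - b'%:R]
    =i [:: a%:R + c; - a%:R + c; b%:R + c; - b%:R + c] ->
  theta_circulant N 2 t [fset e; a; b]%fset = circulant N [fset e'; a'; b']%fset.
Proof.
move=> oe oa ob oe' oa' ob' eqE c eqA; apply/theta_circulantP => z.
rewrite is_jump_parity // is_jump_untwist // eqE; case: ifP => // _.
by have := eqA z; rewrite !inE.
Qed.

Lemma circulant_reflexive_mul3 (y e a b : nat) :
  circulant N (reflexive_mul N y [fset e; a; b]%fset) =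
  circulant N [fset y * e; y * a; y * b]%fset%N.
Proof.
apply/setP => E; rewrite !inE; apply: eq_existsb => u; apply: eq_existsb => v.
congr (_ && _); rewrite !circ_adjE.
apply/(is_jump_reflexive_mul _ _ _ N1)/is_jumpP => [[r]|[r]].
  by rewrite !inE => rR zr; exists (y * r)%N => //; rewrite !inE;
     case/orP: rR => [/orP[]|] /eqP->; rewrite eqxx ?orbT.
by rewrite !inE => /orP[/orP[]|] /eqP-> zr; [exists e | exists a | exists b];
   rewrite ?inE ?eqxx ?orbT.
Qed.

(* Symmetry of [C_N(S)] makes the odd jumps of [R] invariant under [4 t]. *)
Lemma theta_circulant_shift (t : nat) (R S : {fset nat}) (z : 'Z_N) :
  theta_circulant N 2 t R = circulant N S -> odd z ->
  is_jump R (z + (4 * t)%:R) = is_jump R z.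
Proof.
move=> /theta_circulantP e oz.
have ozt (c : nat) : odd (z + (2 * c)%:R)%R.
  by rewrite odd_ZpD odd_Zp_nat oddM oz.
(* For [S], the element z + 2t corresponds to z in [R], and its negative to -(z + 4t). *)
have := e (z + (2 * t)%:R); rewrite /untwist ozt addrK => <-.
rewrite -[RHS]is_jumpN e /untwist odd_ZpN ozt.
by rewrite -is_jumpN; congr is_jump; rewrite !natrM; ring.
Qed.

(** Translation by T = 4t preserves the set of a, -a, b, -b; the cases record where it sends a and
    -a. *)
Lemma theta_circulant_shift3 (t e a b : nat) (S : {fset nat}) :
  ~~ odd e -> odd a -> odd b -> a%:R *+ 2 != 0 :> 'Z_N ->
  theta_circulant N 2 t [fset e; a; b]%fset = circulant N S ->
  let T := (4 * t)%:R : 'Z_N in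
  [\/ T = 0, a%:R *+ 2 = T, a%:R *+ 2 + T = 0
    | T *+ 2 = 0 /\ (a%:R + T = b%:R \/ a%:R + b%:R + T = 0)].
Proof.
move=> oe oa ob a2 eS T.
have inA (z : 'Z_N) : z = a%:R \/ z = - a%:R ->
    [|| z + T == a%:R, z + T == - a%:R, z + T == b%:R | z + T == - b%:R].
  move=> za; have oz : odd z by case: za => ->; rewrite ?odd_ZpN odd_Zp_nat.
  have ozT : odd (z + T)%R by rewrite odd_ZpD oz odd_Zp_nat oddM.
  have := theta_circulant_shift eS oz; rewrite !is_jump_parity // oz ozT => ->.
  by case: za => ->; rewrite eqxx ?orbT.
have := inA (- a%:R) (or_intror erefl); have := inA a%:R (or_introl erefl).
case/or4P => /eqP e1.
- by constructor 1; apply: (addrI a%:R); rewrite e1 addr0.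
- by constructor 3; rewrite mulr2n -addrA e1 subrr.
- case/or4P => /eqP e2.
  + by constructor 2; rewrite mulr2n -{1}e2; ring.
  + by constructor 1; apply: (addrI (- a%:R)); rewrite e2 addr0.
  (* Equal images of a and -a would give 2a = 0. *)
  + case/eqP: a2; transitivity ((a%:R + T) - (- a%:R + T)); first by ring.
    by rewrite e1 e2 subrr.
  (* The images are opposite, and their sum is 2T. *)
  + constructor 4; split; last by left.
    transitivity ((a%:R + T) + (- a%:R + T)); first by ring.
    by rewrite e1 e2 subrr.
case/or4P => /eqP e2.
- by constructor 2; rewrite mulr2n -{1}e2; ring.
- by constructor 1; apply: (addrI (- a%:R)); rewrite e2 addr0.
- constructor 4; split; last by right; rewrite addrAC e1 addNr.
  transitivity ((a%:R + T) + (- a%:R + T)); first by ring.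
  by rewrite e1 e2 addNr.
case/eqP: a2; transitivity ((a%:R + T) - (- a%:R + T)); first by ring.
by rewrite e1 e2 subrr.
Qed.

End Even.

(** * Necessary conditions on t, a and b *)

(** Turns the condition S ≠ yR into an inequality of graphs with unreduced jumps, so that an
    explicit description of the image can contradict it. *)
Lemma type2_via_neq_mul3 (n t y a b : nat) (S : {fset nat}) :
  (1 < n)%N -> (y < n)%N -> coprime n y ->
  type2_via n 2 t [fset 2; a; b]%fset S ->
  theta_circulant n 2 t [fset 2; a; b]%fset <>
  circulant n [fset y * 2; y * a; y * b]%fset%N.
Proof.
move=> n1 yn cny [[jR jS] _ eS neS]; rewrite -circulant_reflexive_mul3 // eS => e.
apply: (neS y yn cny); apply: (circulant_inj n1) => //.
exact: jump_set_reflexive_mul.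
Qed.

Lemma theta_circulant_id (N t a b : nat) :
  (1 < N)%N -> ~~ odd N -> odd a -> odd b -> (N %| 2 * t)%N ->
  theta_circulant N 2 t [fset 2; a; b]%fset =
  circulant N [fset 1 * 2; 1 * a; 1 * b]%fset%N.
Proof.
move=> N1 No oa ob Nt; rewrite !mul1n; apply: theta_circulant3 => //.
have /eqP -> : (2 * t)%:R == 0 :> 'Z_N by rewrite natZp_eq0.
by move=> z; rewrite !addr0.
Qed.

(** With N = 8k and t = N/4, the shift is c = N/2. The multiplier 1 + N/2 adds c to every odd
    residue and fixes 2. *)
Lemma theta_circulant_quarter (k a b : nat) :
  (0 < k)%N -> odd a -> odd b ->
  theta_circulant (k * 8) 2 (2 * k) [fset 2; a; b]%fset =
  circulant (k * 8)
    [fset (1 + 4 * k) * 2; (1 + 4 * k) * a; (1 + 4 * k) * b]%fset%N.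
Proof.
move=> k0 oa ob.
have N1 : (1 < k * 8)%N by lia.
have No : ~~ odd (k * 8) by rewrite oddM andbF.
set c : 'Z_(k * 8) := (2 * (2 * k))%:R.
have c2 : c + c = 0.
  by rewrite -natrD; apply/eqP; rewrite natZp_eq0 //; apply/dvdnP; exists 1%N; lia.
have mulc (r : nat) : odd r -> ((1 + 4 * k) * r)%:R = r%:R + c.
  move=> or; have [j ->] : exists j, r = (1 + j * 2)%N.
    by exists r./2; rewrite muln2 -[LHS]odd_double_half or.
  transitivity ((1 + j * 2)%:R + c + (c + c) * j%:R).
    by rewrite /c !(natrD, natrM); ring.
  by rewrite c2 mul0r addr0.
apply: theta_circulant3 => //; try lia.
  transitivity (2%:R + (c + c)); last by rewrite c2 addr0.
  by rewrite /c !(natrD, natrM); ring.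
have Nc : - c = c by apply/esym/eqP; rewrite -addr_eq0 c2.
by rewrite -/c !mulc // !opprD Nc.
Qed.

(** The odd jumps up to sign are k, 3k, 5k, 7k modulo 8k, and a shift by 2k or 6k permutes them. *)
Lemma theta_circulant_eighth (k q : nat) :
  (0 < k)%N -> odd k -> q = 1%N \/ q = 3%N ->
  theta_circulant (k * 8) 2 (q * k) [fset 2; k; 3 * k]%fset%N =
  circulant (k * 8) [fset 1 * 2; 1 * k; 1 * (3 * k)]%fset%N.
Proof.
move=> k0 ok q13; rewrite !mul1n.
have N1 : (1 < k * 8)%N by lia.
apply: theta_circulant3 => //; try lia.
set h : 'Z_(k * 8) := k%:R.
have h8 : h *+ 8 = 0 by rewrite -mulr_natr -natrM pchar_Zp.
rewrite !natrM -/h => z; rewrite !inE; case: q13 => ->.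
  have -> : h + 2 * (1 * h) = 3 * h by ring.
  have -> : - h + 2 * (1 * h) = h by ring.
  have -> : 3 * h + 2 * (1 * h) = - (3 * h) + h *+ 8 by ring.
  have -> : - (3 * h) + 2 * (1 * h) = - h by ring.
  by rewrite h8 addr0; do 4!case: (z == _).
have -> : h + 2 * (3 * h) = - h + h *+ 8 by ring.
have -> : - h + 2 * (3 * h) = - (3 * h) + h *+ 8 by ring.
have -> : 3 * h + 2 * (3 * h) = h + h *+ 8 by ring.
have -> : - (3 * h) + 2 * (3 * h) = 3 * h by ring.
by rewrite h8 !addr0; do 4!case: (z == _).
Qed.

Lemma type2_via3_necessary (n t a b : nat) (S : {fset nat}) :
  (1 < n)%N -> odd a -> odd b -> (a < b <= n %/ 2)%N -> (t <= n %/ 2)%N ->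
  type2_via n 2 t [fset 2; a; b]%fset S ->
  [/\ 8 %| n, a + b = n %/ 2, a <> n %/ 8 & t = n %/ 8 \/ t = 3 * n %/ 8]%N.
Proof.
move=> N1 oa ob /andP[ab bn] tn typ; have [_ [_ _ _ /dvdnP[k nE]] eS _] := typ.
rewrite (_ : 2 ^ 3 = 8)%N // in nE; subst n.
have k0 : (0 < k)%N by lia.
have No : ~~ odd (k * 8) by rewrite oddM andbF.
have bk : (b < 4 * k)%N by lia.
have tk : (t <= 4 * k)%N by lia.
have eq0 (u : nat) : u%:R = 0 :> 'Z_(k * 8) -> exists q, u = (q * (k * 8))%N.
  by move/eqP; rewrite natZp_eq0 // => /dvdnP.
have neq1 := type2_via_neq_mul3 N1 N1 (coprimen1 _) typ.
have t_half : ~~ (k * 8 %| 2 * t)%N.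
  by apply/negP => tN; case: neq1; apply: theta_circulant_id.
(* Excluded by the multiplier 1 + 4k, which is below 8k and coprime to it. *)
have t_quarter : t <> (2 * k)%N.
  move=> tE; apply: type2_via_neq_mul3 typ _; last first.
  - by rewrite tE; apply: theta_circulant_quarter.
  - rewrite coprimeMl; apply/andP; split.
      by rewrite addnC /coprime gcdnMDl gcdn1.
    by rewrite (@coprimeXl 3 2) // coprime2n; lia.
  - lia.
  - by [].
(* As t is at most n/2, this would leave t = 0, n/4 or n/2, all excluded above. *)
have T0 : (4 * t)%:R <> 0 :> 'Z_(k * 8).
  case/eq0 => q tq; have : (q < 3)%N by nia.
  case: q tq => [|[|[|]]] // tq _.
  - by case/negP: t_half; rewrite (_ : t = 0)%N //; lia.
  - by apply: t_quarter; lia.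
  - by case/negP: t_half; apply/dvdnP; exists 1%N; lia.
have a2 : a%:R *+ 2 != 0 :> 'Z_(k * 8).
  by apply/eqP; rewrite -(mulr_natr _ 2) -natrM => /eq0[q]; lia.
(* Since 2a is 2 modulo 4 while 4t and n are divisible by 4, 2a is neither 4t nor -4t modulo n. *)
case: (theta_circulant_shift3 N1 No _ oa ob a2 eS) => //.
- move/eqP; rewrite -(mulr_natr _ 2) -natrM natZp_eq // => /eqP. lia.
- rewrite -(mulr_natr _ 2) -natrM -natrD => /eq0[q]; lia.
rewrite -(mulr_natr _ 2) -natrM => -[/eq0[q tq] abT].
have tE : t = (q * k)%N by lia.
(* The bound on t gives q at most 4; the even values 0, 2, 4 are already excluded. *)
have q13 : q = 1%N \/ q = 3%N.
  have : (q < 5)%N by nia.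
  case: q tE {tq} => [|[|[|[|[|]]]]] // tE _; [|by left|by right|].
  - by case: T0; rewrite tE.
  - by case/negP: t_half; apply/dvdnP; exists 1%N; lia.
have T4 : (4 * t)%:R = (4 * k)%:R :> 'Z_(k * 8).
  apply/eqP; rewrite natZp_eq // tE; case: q13 => ->; first by rewrite mul1n.
  by rewrite (_ : 4 * (3 * k) = k * 8 + 4 * k)%N ?modnDl //; lia.
(* From a < b < 4k, b cannot be a + 4k modulo 8k, and a + b + 4k is a positive multiple of 8k below
   12k. *)
have abE : (a + b = 4 * k)%N.
  case: abT; rewrite T4 -!natrD.
    by move/eqP; rewrite natZp_eq // !modn_small; lia.
  by move/eq0 => [[|[|r]]]; nia.
split.
- by rewrite dvdn_mull.
- lia.
(* If a = n/8 then b = 3n/8 and the image is the original graph, against y = 1. *)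
- rewrite mulnK // => aE; apply: neq1; rewrite tE aE (_ : b = 3 * k)%N; last by lia.
  by apply: theta_circulant_eighth => //; rewrite -aE.
- by case: q13 tE => -> ->; [left | right]; lia.
Qed.

(** * The family of order 8n *)

Section Family.
Variables (n a : nat).
Hypotheses (n0 : (0 < n)%N) (oa : odd a) (an : (a <= 2 * n)%N).
Local Notation Z := 'Z_(8 * n).
Local Notation R := [fset 2; a; (4 * n - a)%N]%fset.
Local Notation S := [fset 2; (2 * n - a)%N; (2 * n + a)%N]%fset.

Let N1 : (1 < 8 * n)%N. Proof. lia. Qed.
Let h8 : (n%:R : Z) *+ 8 = 0.
Proof.
by rewrite -(mulr_natr _ 8) -natrM; apply/eqP; rewrite natZp_eq0 // (mulnC n).
Qed.

Lemma theta_circulant_swap (q : nat) : q = 1%N \/ q = 3%N ->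
  theta_circulant (8 * n) 2 (q * n) R = circulant (8 * n) S.
Proof.
move=> q13; apply: theta_circulant3 => //; try lia.
rewrite (natrD _ (2 * n) a) !natrB //; last by lia.
rewrite !natrM; set h : Z := n%:R; set x : Z := a%:R => z; rewrite !inE.
case: q13 => ->.
  have -> : x + 2 * (1 * h) = 2 * h + x by ring.
  have -> : - x + 2 * (1 * h) = 2 * h - x by ring.
  have -> : 4 * h - x + 2 * (1 * h) = - (2 * h + x) + h *+ 8 by ring.
  have -> : - (4 * h - x) + 2 * (1 * h) = - (2 * h - x) by ring.
  by rewrite h8 addr0; do 4!case: (z == _).
have -> : x + 2 * (3 * h) = - (2 * h - x) + h *+ 8 by ring.
have -> : - x + 2 * (3 * h) = - (2 * h + x) + h *+ 8 by ring.
have -> : 4 * h - x + 2 * (3 * h) = 2 * h - x + h *+ 8 by ring.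
have -> : - (4 * h - x) + 2 * (3 * h) = 2 * h + x by ring.
by rewrite h8 !addr0; do 4!case: (z == _).
Qed.

(** The shift 4n exchanges a with -(4n - a) and -a with 4n - a. *)
Lemma theta_circulant_fixed :
  theta_circulant (8 * n) 2 (2 * n) R = circulant (8 * n) R.
Proof.
apply: theta_circulant3 => //; try lia.
rewrite natrB; last by lia.
rewrite !natrM; set h : Z := n%:R; set x : Z := a%:R => z; rewrite !inE.
have -> : x + 2 * (2 * h) = - (4 * h - x) + h *+ 8 by ring.
have -> : - x + 2 * (2 * h) = 4 * h - x by ring.
have -> : 4 * h - x + 2 * (2 * h) = - x + h *+ 8 by ring.
have -> : - (4 * h - x) + 2 * (2 * h) = x by ring.
by rewrite h8 !addr0; do 4!case: (z == _).
Qed.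

(* The only even element of [y R] is [2 y], so [y R = S] forces [2 y] and [2]
   to agree up to sign; doubling another element of [S] then gives [a = n]. *)
Lemma reflexive_mul_neq (y : nat) :
  (a < 2 * n)%N -> n <> a -> coprime (8 * n) y -> S <> reflexive_mul (8 * n) y R.
Proof.
move=> an' na cop e.
have No : ~~ odd (8 * n) by lia.
have oy : odd y.
  by move: cop; rewrite coprimeMl (@coprime_pexpl 3 2) // coprime2n => /andP[].
have inS (r : nat) : r \in S ->
    exists2 q : nat, q \in R & (r%:R : Z) = (y * q)%:R \/ (r%:R : Z) = - (y * q)%:R.
  move=> rS; apply/(is_jump_reflexive_mul _ _ _ N1); rewrite -e.
  by apply/is_jumpP; exists r; auto.
have parity (r q : nat) :
    (r%:R : Z) = (y * q)%:R \/ (r%:R : Z) = - (y * q)%:R -> odd r = odd q.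
  by move=> [] /(congr1 (fun x : Z => odd x));
     rewrite ?odd_ZpN // !odd_Zp_nat // oddM oy.
have y2 : ((y * 2)%:R : Z) = 2 \/ ((y * 2)%:R : Z) = - 2.
  have [|q] := inS 2%N; first by rewrite !inE eqxx.
  rewrite !inE => qR q2; have := parity _ _ q2; case/orP: qR => [/orP[]|] /eqP qE.
  - by move: q2; rewrite qE => -[->|->]; rewrite ?opprK; auto.
  - by rewrite qE oa.
  - by rewrite qE; lia.
have [|q] := inS (2 * n - a)%N; first by rewrite !inE eqxx orbT.
rewrite !inE => qR qS; have oq := parity _ _ qS.
have {}qS : (2 * (2 * n - a))%:R = (2 * q)%:R :> Z \/
            (2 * (2 * n - a))%:R + (2 * q)%:R = 0 :> Z.
  have -> : (2 * (2 * n - a))%:R = (2 * n - a)%:R * 2 :> Z.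
    by rewrite (mulnC 2) natrM.
  have yq : (y * q)%:R * 2 = (y * 2)%:R * q%:R :> Z by rewrite !natrM; ring.
  by case: qS y2 => -> [] y2; rewrite ?mulNr yq y2 natrM;
     [left | right | right | left]; ring.
(* Parity rules out q = 2. For q = a the equality, and for q = 4n - a the vanishing sum, forces a =
   n; the other two alternatives would make 4n vanish modulo 8n. *)
case/orP: qR => [/orP[]|] /eqP qE.
- by move: oq; rewrite qE; lia.
- case: qS => /eqP.
    by rewrite natZp_eq // qE !modn_small; lia.
  by rewrite -natrD natZp_eq0 // qE => /dvdnP[[|r]]; nia.
case: qS => /eqP.
  by rewrite natZp_eq // qE !modn_small; lia.
by rewrite -natrD natZp_eq0 // qE => /dvdnP[[|[|r]]]; nia.
Qed.

Lemma jump_set_swap : (a < 2 * n)%N -> jump_set (8 * n) R /\ jump_set (8 * n) S.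
Proof.
by move=> a2; split=> r; rewrite !inE => /orP[/orP[]|] /eqP->; lia.
Qed.

Lemma type2_via_swap :
  (a < 2 * n)%N -> n <> a -> type2_via (8 * n) 2 n R S.
Proof.
move=> a2 na; split.
- exact: jump_set_swap.
- split=> //.
  + by rewrite fsetUC cardfsU1 cardfs2 !inE; lia.
  + by exists 2%N; rewrite ?inE ?eqxx // dvdn_gcd dvdn_mulr.
  + by rewrite dvdn_mulr.
- by rewrite -[n in theta_circulant _ _ n]mul1n; apply: theta_circulant_swap; left.
- by move=> y _; apply: reflexive_mul_neq.
Qed.

End Family.
End TypeTwo.

(** * Necessity and the family combined *)

Theorem theorem4p8 :
  (forall n s s' t : nat,
     2 <= n ->
     1 <= 2 * s - 1 ->
     2 * s - 1 < 2 * s' - 1 ->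
     2 * s' - 1 <= n %/ 2 ->
     t <= n %/ 2 ->
     (exists S : {fset nat},
        type2_via n 2 t [fset 2; 2 * s - 1; 2 * s' - 1]%fset S) ->
     n = 0 %[mod 8] /\
     (2 * s - 1) + (2 * s' - 1) = n %/ 2 /\
     2 * s - 1 <> n %/ 8 /\
     (t = n %/ 8 \/ t = (3 * n) %/ 8) /\
     (1 <= 2 * s - 1 /\ 2 * s - 1 <= n %/ 4) /\
     16 <= n)
  /\
  (forall n s : nat,
     2 <= n ->
     1 <= 2 * s - 1 ->
     2 * s - 1 <= 2 * n - 1 ->
     n <> 2 * s - 1 ->
     let R := [fset 2; 2 * s - 1; 4 * n - (2 * s - 1)]%fset in
     let S := [fset 2; 2 * n - (2 * s - 1); 2 * n + 2 * s - 1]%fset in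
     (theta_circulant (8 * n) 2 n R = circulant (8 * n) S /\
      theta_circulant (8 * n) 2 (3 * n) R = circulant (8 * n) S) /\
     (theta_circulant (8 * n) 2 n S = circulant (8 * n) R /\
      theta_circulant (8 * n) 2 (3 * n) S = circulant (8 * n) R) /\
     theta_circulant (8 * n) 2 (2 * n) R = circulant (8 * n) R /\
     theta_circulant (8 * n) 2 (2 * n) S = circulant (8 * n) S /\
     type2 (8 * n) 2 R S).
Proof.
split=> [n s s' t n2 a1 ab bn tn [S typ]|n s n2 a1 an na R S].
  have oa : odd (2 * s - 1) by lia.
  have ob : odd (2 * s' - 1) by lia.
  have abn : 2 * s - 1 < 2 * s' - 1 <= n %/ 2 by rewrite ab.
  have [n8 abE aE tE] := type2_via3_necessary n2 oa ob abn tn typ.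
  have [k nE] := dvdnP n8; subst n.
  split; first by rewrite modnMl mod0n.
  rewrite mulnK // in aE *; rewrite mulnK // in tE.
  (* For n = 8 the sum 4 would force 2s - 1 = 1 = n/8, hence n is at least 16; the bound n/4 is half
     of the sum. *)
  by do !split=> //; lia.
have oa : odd (2 * s - 1) by lia.
have n0 : 0 < n by lia.
have a2 : 2 * s - 1 <= 2 * n by lia.
have -> : S = [fset 2; 2 * n - (2 * s - 1); (2 * n + (2 * s - 1))%N]%fset.
  by congr [fset _; _; _]%fset; lia.
rewrite {}/S {}/R; move: (2 * s - 1) a1 an na oa a2 => a a1 an na oa a2.
have oa' : odd (2 * n - a) by lia.
have a2' : 2 * n - a <= 2 * n by lia.
(* Replacing a by 2n - a exchanges [R] and [S], so each claim about [S] is an instance of one about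
   [R]. *)
have RE : [fset 2; 2 * n - (2 * n - a); (2 * n + (2 * n - a))%N]%fset
    = [fset 2; a; 4 * n - a]%fset.
  by congr [fset _; _; _]%fset; lia.
have SE : [fset 2; 2 * n - a; 4 * n - (2 * n - a)]%fset
    = [fset 2; 2 * n - a; (2 * n + a)%N]%fset.
  by congr [fset _; _; _]%fset; lia.
have q13 (q : nat) : q = 1 \/ q = 3 ->
    theta_circulant (8 * n) 2 (q * n) [fset 2; a; 4 * n - a]%fset =
      circulant (8 * n) [fset 2; 2 * n - a; (2 * n + a)%N]%fset /\
    theta_circulant (8 * n) 2 (q * n) [fset 2; 2 * n - a; (2 * n + a)%N]%fset =
      circulant (8 * n) [fset 2; a; 4 * n - a]%fset.
  move=> qE; split; first exact: theta_circulant_swap.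
  by rewrite -RE -SE; apply: theta_circulant_swap.
have [t1R t1S] := q13 1 (or_introl erefl); rewrite mul1n in t1R t1S.
have [t3R t3S] := q13 3 (or_intror erefl).
do !split=> //.
- exact: theta_circulant_fixed.
- by rewrite -SE; apply: theta_circulant_fixed.
- by exists n; apply: type2_via_swap => //; lia.
Qed.
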